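(* Let $(T,[-,-,-],\cdot)$ be a truss and let $M$ be a left $T$-module. (1) The kernel of a morphism of left $T$-modules is an induced submodule of its domain; that is, for every morphism $\varphi$ of left $T$-modules and every $e\in\operatorname{Im}\varphi$, the set $\varphi^{-1}(e)$ is an induced submodule of the domain of $\varphi$. (2) If $N$ is a (non-empty) sub-heap of $M$, then the quotient heap $M/N$ has a $T$-module structure such that the canonical epimorphism $\pi_N:M\to M/N$ is a module morphism if and only if $N$ is an induced submodule of $M$.
   Context: A heap is a non-empty set $H$ with a ternary operation $[-,-,-]$ satisfying $[v,w,[x,y,z]]=[[v,w,x],y,z]$ and $[x,x,y]=y=[y,x,x]$; it is Abelian if $[x,y,z]=[z,y,x]$. Heap morphisms are functions preserving the ternary operations. A sub-heap is a (non-empty) subset closed under $[-,-,-]$. For a sub-heap $S$ of an Abelian heap $H$, the relation $x\sim_S y$ iff there exists $s\in S$ with $[x,y,s]\in S$ is an equivalence relation, and the set $H/S$ of its classes is a heap (the quotient heap) with $[\bar x,\bar y,\bar z]=\overline{[x,y,z]}$; the canonical epimorphism is $x\mapsto\bar x$. A truss is an Abelian heap $T$ with an associative binary operation satisfying $w[x,y,z]=[wx,wy,wz]$ and $[x,y,z]w=[xw,yw,zw]$. A left $T$-module is an Abelian heap $M$ with a map $T\times M\to M$, $(x,m)\mapsto x\triangleright m$, such that $(xy)\triangleright m=x\triangleright(y\triangleright m)$, $x\triangleright[m,m',m'']=[x\triangleright m,x\triangleright m',x\triangleright m'']$ and $[x,y,z]\triangleright m=[x\triangleright m,y\triangleright m,z\triangleright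 m]$. A morphism of left $T$-modules is a heap morphism $\varphi$ with $\varphi(x\triangleright m)=x\triangleright\varphi(m)$. A submodule is a sub-heap closed under the action. For $e\in M$ the induced action is $x\triangleright^e m=[x\triangleright m,x\triangleright e,e]$; it makes $M$ into a left $T$-module. A sub-heap $N$ of $M$ is an induced submodule if there exists $e\in N$ such that $x\triangleright^e n\in N$ for all $x\in T$, $n\in N$. The kernel of $\varphi$ relative to $e\in\operatorname{Im}\varphi$ is $\varphi^{-1}(e)$ (these are mutually isomorphic heaps for different $e$, and any of them is called the kernel). *)

(* Defs.v *)
From mathcomp Require Import all_boot.
From mathcomp Require Import boolp classical_sets.

Set Implicit Arguments.
Unset Strict Implicit.
Unset Printing Implicit Defensive.

Local Open Scope classical_set_scope.

Declare Scope heap_scope.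
Delimit Scope heap_scope with heap.
Reserved Notation "[% x , y , z ]" (at level 0, x, y, z at level 99,
  format "[%  x ,  y ,  z ]").

Record heap := Heap {
  heap_sort :> Type;
  tern : heap_sort -> heap_sort -> heap_sort -> heap_sort;
  heap_nonempty : inhabited heap_sort;
  ternA : forall v w x y z,
    tern v w (tern x y z) = tern (tern v w x) y z;
  ternxx : forall x y, tern x x y = y;
  tern_xx : forall x y, tern y x x = y }.

Arguments tern {_} _ _ _.
Notation "[% x , y , z ]" := (tern x y z) : heap_scope.
Open Scope heap_scope.

Record abHeap := AbHeap {
  abHeap_heap :> heap;
  ternC : forall x y z : abHeap_heap, [% x, y, z] = [% z, y, x] }.

Definition heap_morphism (H K : heap) (f : H -> K) : Prop :=
  forall x y z, f [% x, y, z] = [% f x, f y, f z].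

Definition sub_heap (H : heap) (S : set H) : Prop :=
  S !=set0 /\ forall x y z, S x -> S y -> S z -> S [% x, y, z].

Definition heap_rel (H : heap) (S : set H) (x y : H) : Prop :=
  exists s, S s /\ S [% x, y, s].

Definition heap_class (H : heap) (S : set H) (x : H) : set H :=
  [set y | heap_rel S x y].

Section QuotientHeap.
Variables (H : abHeap) (S : set H) (hS : sub_heap S).

Lemma heap_rel_refl x : heap_rel S x x.
Proof. by case: hS => -[s Ss] _; exists s; rewrite ternxx. Qed.

Lemma heap_rel_sym x y : heap_rel S x y -> heap_rel S y x.
Proof.
move=> [s [Ss St]]; exists [% x, y, s]; split=> //.
by rewrite ternA tern_xx ternxx.
Qed.

Lemma heap_rel_trans x y z : heap_rel S x y -> heap_rel S y z -> heap_rel S x z.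
Proof.
move=> [s [Ss St]] [u [Su Sv]]; exists u; split=> //.
have -> : [% x, z, u] = [% [% x, y, s], s, [% y, z, u]].
  by rewrite -ternA ternxx ternA tern_xx.
exact: hS.2.
Qed.

Lemma heap_relP x y :
  heap_rel S x y <-> exists s t, S s /\ S t /\ x = [% t, s, y].
Proof.
split=> [[s [Ss St]]|[s [t [Ss [St ->]]]]].
  by exists s, [% x, y, s]; rewrite -ternA ternxx tern_xx.
by exists s; rewrite -ternA ternxx tern_xx.
Qed.

Lemma tern_tern (x a b c z : H) :
  [% x, [% a, b, c], z] = [% [% x, c, b], a, z].
Proof.
have {1}-> : x = [% [% x, c, b], a, [% a, b, c]].
  by rewrite ternA tern_xx -ternA ternxx tern_xx.
by rewrite -ternA ternxx.
Qed.

Lemma heap_rel_tern x x' y y' z z' :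
    heap_rel S x x' -> heap_rel S y y' -> heap_rel S z z' ->
  heap_rel S [% x, y, z] [% x', y', z'].
Proof.
have L a a' b c : heap_rel S a a' -> heap_rel S [% a, b, c] [% a', b, c].
  move=> /heap_relP[s [t [Ss [St ->]]]]; apply/heap_relP.
  by exists s, t; rewrite ternA.
move=> xx' yy' zz'; apply: (heap_rel_trans (L _ _ _ _ xx')).
rewrite [X in heap_rel S X _]ternC.
apply: (heap_rel_trans (L _ _ _ _ zz')); rewrite ternC.
move/heap_relP: yy' => [s [t [Ss [St ->]]]]; apply/heap_relP.
exists t, s; split=> //; split=> //.
rewrite tern_tern ternC (ternC x') ternA (ternC z') -ternA.
by rewrite (ternC z').
Qed.

Lemma heap_classP x y : heap_class S x = heap_class S y <-> heap_rel S x y.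
Proof.
split=> [exy|xy].
  by have : heap_class S y y by [apply: heap_rel_refl]; rewrite -exy.
apply/seteqP; split=> z /= h; last exact: heap_rel_trans h.
by apply: heap_rel_trans h; exact: heap_rel_sym.
Qed.

Definition quot_sort : Type := {A : set H | exists x, A = heap_class S x}.

Lemma quot_inj (A B : quot_sort) : sval A = sval B -> A = B.
Proof.
case: A B => [A hA] [B hB] /= AB; rewrite AB in hA *.
by congr exist; exact: Prop_irrelevance.
Qed.

Definition quot_class (x : H) : quot_sort :=
  exist _ (heap_class S x) (ex_intro _ x erefl).

Definition quot_repr (A : quot_sort) : H := projT1 (cid (svalP A)).

Lemma quot_reprK A : quot_class (quot_repr A) = A.
Proof.
by apply: quot_inj; rewrite /quot_repr; case: cid => x /= ->.
Qed.

Lemma quot_classP x y : quot_class x = quot_class y <-> heap_rel S x y.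
Proof.
rewrite -heap_classP; split=> [/(congr1 sval)//|e].
exact: quot_inj.
Qed.

(* Independent of the representatives chosen by [quot_repr]: see [quot_ternE]. *)
Definition quot_tern (A B C : quot_sort) : quot_sort :=
  quot_class [% quot_repr A, quot_repr B, quot_repr C].

Lemma quot_ternE x y z :
  quot_tern (quot_class x) (quot_class y) (quot_class z)
  = quot_class [% x, y, z].
Proof.
by apply/quot_classP; apply: heap_rel_tern; apply/quot_classP;
  rewrite quot_reprK.
Qed.

Lemma quot_nonempty : inhabited quot_sort.
Proof. by case: (heap_nonempty H) => x; exists; exact: quot_class x. Qed.

Lemma quot_ternA v w x y z :
  quot_tern v w (quot_tern x y z) = quot_tern (quot_tern v w x) y z.
Proof.
rewrite -(quot_reprK v) -(quot_reprK w) -(quot_reprK x) -(quot_reprK y).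
by rewrite -(quot_reprK z) !quot_ternE ternA.
Qed.

Lemma quot_ternxx x y : quot_tern x x y = y.
Proof. by rewrite -(quot_reprK x) -(quot_reprK y) quot_ternE ternxx. Qed.

Lemma quot_tern_xx x y : quot_tern y x x = y.
Proof. by rewrite -(quot_reprK x) -(quot_reprK y) quot_ternE tern_xx. Qed.

Lemma quot_ternC x y z : quot_tern x y z = quot_tern z y x.
Proof. by rewrite /quot_tern ternC. Qed.

Definition quot_heap : abHeap :=
  @AbHeap (Heap quot_nonempty quot_ternA quot_ternxx quot_tern_xx) quot_ternC.

Definition quot_pi : H -> quot_heap := quot_class.

End QuotientHeap.

Record truss := Truss {
  truss_abHeap :> abHeap;
  tmul : truss_abHeap -> truss_abHeap -> truss_abHeap;
  tmulA : associative tmul;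
  tmul_ternr : forall w x y z,
    tmul w [% x, y, z] = [% tmul w x, tmul w y, tmul w z];
  tmul_ternl : forall x y z w,
    tmul [% x, y, z] w = [% tmul x w, tmul y w, tmul z w] }.

Arguments tmul {_} _ _.

Record module_structure (T : truss) (M : abHeap) := ModuleStructure {
  action : T -> M -> M;
  actionM : forall x y m, action (tmul x y) m = action x (action y m);
  action_ternr : forall x m m' m'',
    action x [% m, m', m''] = [% action x m, action x m', action x m''];
  action_ternl : forall x y z m,
    action [% x, y, z] m = [% action x m, action y m, action z m] }.

Record leftModule (T : truss) := LeftModule {
  module_abHeap :> abHeap;
  module_str : module_structure T module_abHeap }.

Arguments LeftModule {T} module_abHeap module_str.

Definition act (T : truss) (M : leftModule T) (x : T) (m : M) : M :=
  action (module_str M) x m.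

Definition module_morphism (T : truss) (M M' : leftModule T) (f : M -> M')
    : Prop :=
  heap_morphism f /\ forall (x : T) (m : M), f (act x m) = act x (f m).

Definition induced_act (T : truss) (M : leftModule T) (e : M) (x : T) (m : M)
    : M :=
  [% act x m, act x e, e].

Definition induced_submodule (T : truss) (M : leftModule T) (N : set M)
    : Prop :=
  sub_heap N /\
  exists e, N e /\ forall (x : T) (n : M), N n -> N (induced_act e x n).

Definition kernel_at (T : truss) (M M' : leftModule T) (f : M -> M') (e : M')
    : set M :=
  f @^-1` [set e].

(* Main.v *)
(* Both directions of (2) rest on the observation that, for e in N, x ~ y holds
   iff [x, y, e] lies in N: the action descends to M/N iff n in N implies
   x.n ~ x.e, that is, iff N is stable under the action induced at e. *)
Require Import Defs.
From mathcomp Require Import all_boot.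
From mathcomp Require Import boolp classical_sets.

(** A witness [s] can be traded for any [e] in [S]: inserting [s, s] writes [[% x, y, e]] as a
    bracket of three elements of [S]. *)
Lemma heap_rel_at (H : heap) (S : set H) (hS : sub_heap S) (e x y : H) :
  S e -> (heap_rel S x y <-> S [% x, y, e]).
Proof.
move=> Se; split=> [[s [Ss St]]|St]; last by exists e.
have -> : [% x, y, e] = [% [% x, y, s], s, e] by rewrite -ternA ternxx.
exact: hS.2.
Qed.

Arguments heap_rel_at {H S} hS {e x y}.

Lemma induced_submodule_kernel (T : truss) (P Q : leftModule T) (phi : P -> Q)
    (e : Q) :
  module_morphism phi -> range phi e -> induced_submodule (kernel_at phi e).
Proof.
move=> [phiH phiT] [a _ phia]; split.
  split; first by exists a.
  by move=> x y z; rewrite /kernel_at /= phiH => -> -> ->; rewrite ternxx.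
(* The base point is a preimage [a] of [e]. Since [phi] sends both [n] and [a] to [e], it sends
   [induced_act a x n] to [[% act x e, act x e, e]], which collapses to [e]. *)
exists a; split=> // x n; rewrite /kernel_at /= => phin.
by rewrite /induced_act phiH !phiT phin phia ternxx.
Qed.

Lemma heap_rel_act (T : truss) (M : leftModule T) (N : set M) (x : T)
    (m n : M) :
  induced_submodule N -> heap_rel N m n -> heap_rel N (act x m) (act x n).
Proof.
move=> [hN [e [Ne Nact]]] /(heap_relP N)[s [t [Ns [Nt ->]]]].
rewrite /act action_ternr -!/(act _ _); apply/(heap_rel_at hN Ne).
rewrite -ternA ternxx.
(* Here [m] is [[% t, s, n]], and [act x n] has cancelled. Passing to induced actions changes
   nothing, as the two copies of [act x e] and [e] cancel, but it makes all three entries lie in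
   [N]. *)
have -> : [% act x t, act x s, e] =
    [% induced_act e x t, induced_act e x s, e].
  by rewrite /induced_act tern_tern -!ternA ternxx ternA tern_xx.
by apply: hN.2 => //; exact: Nact.
Qed.

Section QuotientModule.
Context {T : truss} {M : leftModule T} {N : set M} (hN : sub_heap N).
Hypothesis indN : induced_submodule N.

Let pi : M -> quot_heap hN := quot_pi hN.

(** Computed on the chosen representative; [quot_actE] shows that, for [N] an induced submodule, the
    choice is immaterial. *)
Definition quot_act (x : T) (A : quot_heap hN) : quot_heap hN :=
  pi (act x (quot_repr A)).

Lemma quot_actE x m : quot_act x (pi m) = pi (act x m).
Proof.
apply/(quot_classP hN)/heap_rel_act => //.
by apply/(quot_classP hN); rewrite quot_reprK.
Qed.

Lemma quot_pi_tern x y z : [% pi x, pi y, pi z] = pi [% x, y, z].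
Proof. exact: (quot_ternE hN). Qed.

(** Lets each module law on the quotient be checked on classes [pi m], where it reduces to the same
    law in [M]. *)
Lemma quot_pi_surj (A : quot_heap hN) : exists m, A = pi m.
Proof. by exists (quot_repr A); rewrite [RHS]quot_reprK. Qed.

Lemma quot_actM x y A : quot_act (tmul x y) A = quot_act x (quot_act y A).
Proof.
by have [m ->] := quot_pi_surj A; rewrite !quot_actE /act actionM.
Qed.

Lemma quot_act_ternr x A B C :
  quot_act x [% A, B, C] = [% quot_act x A, quot_act x B, quot_act x C].
Proof.
have [a ->] := quot_pi_surj A; have [b ->] := quot_pi_surj B.
have [c ->] := quot_pi_surj C.
by rewrite quot_pi_tern !quot_actE quot_pi_tern /act action_ternr.
Qed.

Lemma quot_act_ternl x y z A :
  quot_act [% x, y, z] A = [% quot_act x A, quot_act y A, quot_act z A].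
Proof.
have [a ->] := quot_pi_surj A.
by rewrite !quot_actE quot_pi_tern /act action_ternl.
Qed.

Definition quot_module : module_structure T (quot_heap hN) :=
  {| action := quot_act; actionM := quot_actM;
     action_ternr := quot_act_ternr; action_ternl := quot_act_ternl |}.

Lemma quot_pi_morphism :
  @module_morphism T M (LeftModule (quot_heap hN) quot_module) pi.
Proof.
split=> [x y z|x m]; first by rewrite quot_pi_tern.
exact/esym/quot_actE.
Qed.

End QuotientModule.

Lemma induced_submodule_quot (T : truss) (M : leftModule T) (N : set M)
    (hN : sub_heap N) (s : module_structure T (quot_heap hN)) :
  @module_morphism T M (LeftModule (quot_heap hN) s) (quot_pi hN) ->
  induced_submodule N.
Proof.
move=> [_ piT]; split=> //; have [e Ne] := hN.1.
(* Any [e] in [N] serves: [induced_act e x n] lies in [N] exactly when [act x n] and [act x e] share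
   a class. Equivariance of [quot_pi] gives this, because [n] and [e] already share one. *)
exists e; split=> // x n Nn; apply/(heap_rel_at hN Ne)/(quot_classP hN).
have pine : quot_pi hN n = quot_pi hN e.
  by apply/(quot_classP hN)/(heap_rel_at hN Ne); exact: hN.2.
by have := piT x n; rewrite pine -piT.
Qed.

Theorem proposition4p32 (T : truss) (M : leftModule T) :
  (forall (P Q : leftModule T) (phi : P -> Q),
     module_morphism phi ->
     forall e : Q, range phi e -> induced_submodule (kernel_at phi e)) /\
  (forall (N : set M) (hN : sub_heap N),
     (exists s : module_structure T (quot_heap hN),
        @module_morphism T M (LeftModule (quot_heap hN) s) (quot_pi hN)) <->
     induced_submodule N).
Proof.
split=> [P Q phi phiM e|N hN]; first exact: induced_submodule_kernel.
split=> [[s]|indN]; first exact: induced_submodule_quot.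
by exists (quot_module hN indN); exact: quot_pi_morphism.
Qed.
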